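(* Let $\lambda$ be a nonzero real number and let $\phi_{n,\lambda}(x)$ ($n\ge 0$) be the degenerate Bell polynomials. Then for every integer $n\ge 1$, $$\sum_{k=0}^{n-1}\binom{n}{k}\langle 1\rangle_{n-k,\lambda}(-1)^{k}\phi_{k,\lambda}(x)=\sum_{k=0}^{n}\binom{n}{k}\langle 1\rangle_{n-k,\lambda}(-1)^{k-1}\phi_{k,\lambda}^{\prime}(x),$$ where $\phi_{k,\lambda}^{\prime}(x)=\frac{d}{dx}\phi_{k,\lambda}(x)$.
   Context: For a nonzero real number $\lambda$: generalized falling factorials $(x)_{0,\lambda}=1$, $(x)_{n,\lambda}=x(x-\lambda)\cdots(x-(n-1)\lambda)$ for $n\ge 1$; generalized rising factorials $\langle x\rangle_{0,\lambda}=1$, $\langle x\rangle_{n,\lambda}=x(x+\lambda)\cdots(x+(n-1)\lambda)$ for $n\ge 1$. With $(x)_0=1$ and $(x)_n=x(x-1)\cdots(x-n+1)$ for $n\ge 1$, the degenerate Stirling numbers of the second kind ${n \brace k}_{\lambda}$ ($0\le k\le n$) are defined by the polynomial identity $(x)_{n,\lambda}=\sum_{k=0}^{n}{n \brace k}_{\lambda}(x)_{k}$, $n\ge 0$. The degenerate Bell polynomials are $\phi_{n,\lambda}(x)=\sum_{k=0}^{n}{n \brace k}_{\lambda}x^{k}$. *)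

(* Defs.v *)
From mathcomp Require Import all_boot all_order all_algebra.
From mathcomp Require Import reals.

Set Implicit Arguments.
Unset Strict Implicit.
Unset Printing Implicit Defensive.

Import GRing.Theory.
Local Open Scope ring_scope.

Definition fallfact (A : comNzRingType) (x : A) (n : nat) : A :=
  \prod_(i < n) (x - i%:R).

Definition gfallfact (A : comNzRingType) (lam x : A) (n : nat) : A :=
  \prod_(i < n) (x - i%:R * lam).

Definition grisefact (A : comNzRingType) (lam x : A) (n : nat) : A :=
  \prod_(i < n) (x + i%:R * lam).

(* The polynomial (x)_{n,lam} is [gfallfact lam%:P 'X n], and (x)_k is
   [fallfact 'X k], both computed in the ring {poly R}.  The predicate says that
   s 0, ..., s n are coefficients of (x)_{n,lam} on (x)_0, ..., (x)_n. *)
Definition is_dstirling2 (R : comNzRingType) (lam : R) (n : nat)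
    (s : {ffun 'I_n.+1 -> R}) : bool :=
  gfallfact lam%:P 'X n == \sum_(k < n.+1) s k *: fallfact ('X : {poly R}) k.

Lemma size_fallfactX (R : comNzRingType) (n : nat) :
  size (fallfact ('X : {poly R}) n) = n.+1.
Proof.
rewrite /fallfact (eq_bigr (fun i : 'I_n => 'X - (i%:R)%:P)); last first.
  by move=> i _; rewrite polyCMn.
by rewrite -big_enum size_prod_XsubC size_enum_ord.
Qed.

Lemma monic_fallfactX (R : comNzRingType) (n : nat) :
  fallfact ('X : {poly R}) n \is monic.
Proof.
by apply: monic_prod => i _; rewrite -[i%:R]polyCMn monicXsubC.
Qed.

Lemma fallfactX_span (R : comNzRingType) (n : nat) (p : {poly R}) :
  (size p <= n)%N ->
  exists s : {ffun 'I_n -> R},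
    p = \sum_(k < n) s k *: fallfact ('X : {poly R}) k.
Proof.
elim: n p => [|n IHn] p sp.
  exists [ffun=> 0]; rewrite big_ord0.
  by apply/eqP; rewrite -size_poly_leq0.
have lc : (fallfact ('X : {poly R}) n)`_n = 1.
  have /monicP := monic_fallfactX R n.
  by rewrite /lead_coef size_fallfactX.
have [|s Es] := IHn (p - p`_n *: fallfact 'X n).
  apply/leq_sizeP => j; rewrite leq_eqVlt => /predU1P[<-|nj].
    by rewrite coefB coefZ lc mulr1 subrr.
  have pj : p`_j = 0 by apply/nth_default/(leq_trans sp).
  have fj : (fallfact ('X : {poly R}) n)`_j = 0.
    by rewrite nth_default // size_fallfactX.
  by rewrite coefB coefZ pj fj mulr0 subr0.
exists [ffun k : 'I_n.+1 => if unlift ord_max k is Some j then s j else p`_n].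
rewrite big_ord_recr /= ffunE unlift_none.
rewrite (eq_bigr (fun k : 'I_n => s k *: fallfact 'X k)) -?Es ?subrK // => k _.
suff -> : widen_ord (leqnSn n) k = lift ord_max k by rewrite ffunE liftK.
by apply: val_inj; rewrite /= /bump leqNgt ltn_ord.
Qed.

Lemma fallfactX_free (R : comNzRingType) (n : nat) (s : 'I_n -> R) :
  \sum_(k < n) s k *: fallfact ('X : {poly R}) k = 0 -> forall k, s k = 0.
Proof.
elim: n s => [|n IHn] s; first by move=> _ [].
rewrite big_ord_recr /= => E.
have lc : (fallfact ('X : {poly R}) n)`_n = 1.
  have /monicP := monic_fallfactX R n.
  by rewrite /lead_coef size_fallfactX.
have sn0 : s ord_max = 0.
  have := congr1 (fun q : {poly R} => q`_n) E.
  rewrite coefD coefZ lc mulr1 coef0 coef_sum big1 ?add0r // => k _.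
  by rewrite coefZ nth_default ?mulr0 // size_fallfactX.
move: E; rewrite sn0 scale0r addr0 => /IHn s0 k.
have [j ->|->//] := unliftP ord_max k.
rewrite -(s0 j); congr s; apply: val_inj.
by rewrite /= /bump leqNgt ltn_ord.
Qed.

Lemma is_dstirling2_ex (R : comNzRingType) (lam : R) (n : nat) :
  exists s : {ffun 'I_n.+1 -> R}, is_dstirling2 lam s.
Proof.
have [|s Es] := @fallfactX_span R n.+1 (gfallfact lam%:P 'X n); last first.
  by exists s; apply/eqP.
rewrite /gfallfact (eq_bigr (fun i : 'I_n => 'X - (i%:R * lam)%:P)); last first.
  by move=> i _; rewrite polyCM polyCMn.
by rewrite -big_enum size_prod_XsubC size_enum_ord.
Qed.

Lemma is_dstirling2_uniq (R : comNzRingType) (lam : R) (n : nat)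
    (s t : {ffun 'I_n.+1 -> R}) :
  is_dstirling2 lam s -> is_dstirling2 lam t -> s = t.
Proof.
move=> /eqP Es /eqP Et; apply/ffunP => k; apply/eqP; rewrite -subr_eq0.
apply/eqP; apply: (fallfactX_free (s := fun k => s k - t k)).
under eq_bigr do rewrite scalerBl.
by rewrite sumrB -Es -Et subrr.
Qed.

Definition dstirling2 (R : comNzRingType) (lam : R) (n : nat) :
  {ffun 'I_n.+1 -> R} := xchoose (is_dstirling2_ex lam n).

Lemma dstirling2P (R : comNzRingType) (lam : R) (n : nat) :
  gfallfact lam%:P 'X n =
  \sum_(k < n.+1) dstirling2 lam n k *: fallfact ('X : {poly R}) k.
Proof. exact/eqP/(xchooseP (is_dstirling2_ex lam n)). Qed.

Definition dbell (R : comNzRingType) (lam : R) (n : nat) : {poly R} :=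
  \sum_(k < n.+1) dstirling2 lam n k *: 'X^k.

(* Main.v *)
Require Import Defs.
From HB Require Import structures.
From mathcomp Require Import all_boot all_order all_algebra.
From mathcomp Require Import reals ring.

(** Let U be the linear operator on polynomials sending X^k to the falling
    factorial (x)_k.  It is injective, it sends the degenerate Bell polynomial
    phi_k to (x)_{k,lam} ([umbral_dbell]), and it intertwines the derivative
    with the forward difference f(x) |-> f(x + 1) - f(x) ([umbral_deriv]),
    because (x + 1)_k - (x)_k = k (x)_{k-1}.

    Hence U sends phi_k + phi_k' to (x + 1)_{k,lam}.  Writing
    c_k = C(n,k) <1>_{n-k,lam} (-1)^k, with c_n = (-1)^n, the claim is that the
    sum of c_k (phi_k + phi_k') over 0 <= k <= n equals (-1)^n phi_n
    ([sum_grisefact_dbell]).  After U this says that the sum of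
    c_k (x + 1)_{k,lam} is (-1)^n (x)_{n,lam} ([sum_grisefact_shift]), which,
    since <1>_{m,lam} = (-1)^m (-1)_{m,lam}, is the Vandermonde identity
    ([gfallfactD]) for the decomposition x = (x + 1) + (-1).  The argument is
    valid over every nonzero commutative ring. *)

Import GRing.Theory.
Local Open Scope ring_scope.

Section Factorials.

Variable A : comNzRingType.
Implicit Types lam x y : A.

Lemma gfallfactS lam x n :
  gfallfact lam x n.+1 = gfallfact lam x n * (x - n%:R * lam).
Proof. by rewrite /gfallfact big_ord_recr. Qed.

(** The Vandermonde identity for generalized falling factorials. *)
Lemma gfallfactD lam x y n :
  gfallfact lam (x + y) n =
  \sum_(k < n.+1) (gfallfact lam x k * gfallfact lam y (n - k)) *+ 'C(n, k).
Proof.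
elim: n => [|n IHn].
  by rewrite big_ord_recl big_ord0 /gfallfact !big_ord0 mulr1 addr0.
(* The last factor splits as (x - k lam) + (y - (n - k) lam) in the k-th term;
   the two resulting sums recombine by Pascal's rule. *)
have step (k : 'I_n.+1) :
    (gfallfact lam x k * gfallfact lam y (n - k)) *+ 'C(n, k)
      * (x + y - n%:R * lam) =
    (gfallfact lam x k.+1 * gfallfact lam y (n - k)) *+ 'C(n, k)
    + (gfallfact lam x k * gfallfact lam y (n - k).+1) *+ 'C(n, k).
  have -> : x + y - n%:R * lam = (x - k%:R * lam) + (y - (n - k)%:R * lam).
    rewrite addrACA -opprD -mulrDl -natrD subnKC //.
    by rewrite -ltnS ltn_ord.
  by rewrite mulrnAl mulrDr mulrnDl !gfallfactS mulrA mulrAC.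
rewrite gfallfactS IHn mulr_suml (eq_bigr _ (fun k _ => step k)) big_split /=.
rewrite [in RHS]big_ord_recl subn0 bin0.
under [X in _ = _ + X]eq_bigr => k _ do
  rewrite lift0 binS mulrnDr subSS.
rewrite [in RHS]big_split /= [RHS]addrA [LHS]addrC; congr (_ + _).
rewrite big_ord_recl [in RHS]big_ord_recr /= (bin_small (ltnSn n)) mulr0n addr0.
rewrite subn0 bin0; congr (_ + _); apply: eq_bigr => k _.
by rewrite /bump /= add1n subnSK.
Qed.

Lemma grisefactE lam x n :
  grisefact lam x n = (-1) ^+ n * gfallfact lam (- x) n.
Proof.
rewrite /grisefact /gfallfact.
rewrite -[X in (-1) ^+ X]card_ord -prodrN.
by apply: eq_bigr => i _; rewrite opprB opprK addrC.
Qed.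

(** For k = 0 the truncated predecessor is harmless: the factor k vanishes. *)
Lemma fallfact_diff x k :
  fallfact (x + 1) k - fallfact x k = fallfact x k.-1 *+ k.
Proof.
case: k => [|k]; first by rewrite /fallfact !big_ord0 subrr.
rewrite /fallfact big_ord_recl big_ord_recr /=.
rewrite (eq_bigr (fun i : 'I_k => x - i%:R)).
  by ring.
by move=> i _; rewrite /bump /= add1n -natr1 opprD addrACA subrr addr0.
Qed.

Lemma sum_grisefact_shift lam x n :
  \sum_(k < n.+1) ('C(n, k)%:R * grisefact lam 1 (n - k) * (-1) ^+ k)
     * gfallfact lam (x + 1) k = (-1) ^+ n * gfallfact lam x n.
Proof.
rewrite -[in RHS](addrK 1 x) gfallfactD mulr_sumr; apply: eq_bigr => k _.
rewrite grisefactE -mulr_natl.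
have -> : (-1) ^+ n = (-1) ^+ (n - k) * (-1) ^+ k :> A.
  by rewrite -exprD subnK // -ltnS ltn_ord.
by ring.
Qed.

End Factorials.

Section Umbral.

Variable R : comNzRingType.
Implicit Types (p : {poly R}) (lam : R).

(** The linear operator U sending X^k to the falling factorial (x)_k. *)
Definition umbral p : {poly R} := \sum_(k < size p) p`_k *: fallfact 'X k.

Lemma umbral_widen m p :
  (size p <= m)%N -> umbral p = \sum_(k < m) p`_k *: fallfact 'X k.
Proof.
move=> le_p_m; rewrite /umbral.
rewrite (big_ord_widen m (fun k => p`_k *: fallfact ('X : {poly R}) k)) //.
rewrite big_mkcond; apply: eq_bigr => k _.
by case: ltnP => // /(nth_default 0) ->; rewrite scale0r.
Qed.

Lemma umbral_is_linear : linear umbral.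
Proof.
move=> a p q; pose m := maxn (size p) (size q).
have hp : (size p <= m)%N by apply: leq_maxl.
have hq : (size q <= m)%N by apply: leq_maxr.
have hpq : (size (a *: p + q)%R <= m)%N.
  rewrite (leq_trans (size_polyD _ _)) // geq_max hq andbT.
  exact: leq_trans (size_scale_leq _ _) hp.
rewrite !(umbral_widen m) // scaler_sumr -big_split; apply: eq_bigr => k _ /=.
by rewrite coefD coefZ scalerDl scalerA.
Qed.

HB.instance Definition _ :=
  GRing.isLinear.Build R {poly R} {poly R} _ umbral umbral_is_linear.

Lemma umbralXn k : umbral 'X^k = fallfact 'X k.
Proof.
rewrite /umbral size_polyXn big_ord_recr /= coefXn eqxx scale1r big1 ?add0r //.
by move=> i _; rewrite coefXn ltn_eqF // scale0r.
Qed.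

Lemma umbral_inj : injective umbral.
Proof.
move=> p q /eqP; rewrite -subr_eq0 -linearB /= => /eqP U0.
apply/eqP; rewrite -subr_eq0; move: (p - q) U0 => r U0; apply/eqP/polyP => k.
rewrite coef0; have [lt_k|/(nth_default 0)//] := ltnP k (size r).
exact: (@fallfactX_free R (size r) (fun i => r`_i) U0 (Ordinal lt_k)).
Qed.

Lemma umbral_dbell lam n : umbral (dbell lam n) = gfallfact lam%:P 'X n.
Proof.
rewrite dstirling2P /dbell linear_sum; apply: eq_bigr => k _.
by rewrite linearZ /= umbralXn.
Qed.

Lemma comp_fallfactX k (q : {poly R}) : fallfact 'X k \Po q = fallfact q k.
Proof.
rewrite /fallfact rmorph_prod; apply: eq_bigr => i _.
by rewrite /= rmorphB /= comp_polyX rmorph_nat.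
Qed.

Lemma comp_gfallfactX lam k (q : {poly R}) :
  gfallfact lam%:P 'X k \Po q = gfallfact lam%:P q k.
Proof.
rewrite /gfallfact rmorph_prod; apply: eq_bigr => i _.
by rewrite /= rmorphB rmorphM /= comp_polyX rmorph_nat comp_polyC.
Qed.

(** U turns the derivative into the forward difference. *)
Lemma umbral_deriv p : umbral p^`() = (umbral p) \Po ('X + 1) - umbral p.
Proof.
rewrite [in LHS](_ : p = \sum_(k < size p) p`_k *: 'X^k); last first.
  by rewrite -{1}[p]coefK poly_def.
rewrite [umbral p]/umbral !linear_sum -big_split; apply: eq_bigr => k _ /=.
rewrite !linearZ /= comp_fallfactX -scalerDr fallfact_diff derivXn.
by rewrite linearMn /= umbralXn.
Qed.

(** The identity over an arbitrary nonzero commutative ring, with all the sums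
    gathered on the left; the summand (-1)^n phi_n there cancels the right-hand side. *)
Lemma sum_grisefact_dbell lam n :
  \sum_(k < n.+1)
     ('C(n, k)%:R * grisefact lam 1 (n - k) * (-1) ^+ k)
       *: (dbell lam k + (dbell lam k)^`()) = (-1) ^+ n *: dbell lam n.
Proof.
apply: umbral_inj; rewrite linear_sum linearZ /= umbral_dbell.
rewrite -mul_polyC rmorphXn rmorphN1 -sum_grisefact_shift.
apply: eq_bigr => k _.
rewrite linearZ linearD /= umbral_deriv umbral_dbell addrC subrK.
rewrite comp_gfallfactX -mul_polyC !rmorphM rmorphXn rmorphN1 rmorph_nat.
do 3!congr (_ * _); rewrite /grisefact rmorph_prod; apply: eq_bigr => i _.
by rewrite rmorphD rmorphM rmorph1 rmorph_nat.
Qed.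

End Umbral.

Theorem theorem2p10 (R : realType) (lam : R) (n : nat) :
  lam != 0 -> (1 <= n)%N ->
  \sum_(0 <= k < n)
     ('C(n, k)%:R * grisefact lam 1 (n - k) * (-1) ^+ k) *: dbell lam k =
  \sum_(0 <= k < n.+1)
     ('C(n, k)%:R * grisefact lam 1 (n - k) * (-1) ^ (k%:Z - 1))
       *: (dbell lam k)^`().
Proof.
move=> _ _; have := sum_grisefact_dbell R lam n.
under eq_bigr do rewrite scalerDr.
rewrite big_split /= [X in X + _]big_ord_recr /= subnn binn.
rewrite {2}/grisefact big_ord0 !mul1r addrAC => /(canRL (addrK _)).
rewrite subrr => /eqP; rewrite addr_eq0 => /eqP sumE.
rewrite !big_mkord sumE -sumrN; apply: eq_bigr => k _.
(* The integer power (-1) ^ (k - 1) is - (-1) ^+ k, also when k = 0. *)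
rewrite -scaleNr -mulrN; congr (_ * _ *: _).
by rewrite expfzDr ?oppr_eq0 ?oner_eq0 // exprN1 invrN1 mulrN1.
Qed.
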